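(* In the setting described in the context, let $\operatorname{zer}(A+B)$ be a nonempty closed convex set, suppose Method 2 does not stop, and let $(x^k)_{k\in\mathbb N}$ be the generated sequence. Define $\bar x:=P_{\operatorname{zer}(A+B)}(x^0)$. Then $(x^k)_{k\in\mathbb N}$ converges strongly to $\bar x$.
   Context: Let $\mathcal H$ be a real Hilbert space with inner product $\langle\cdot,\cdot\rangle$ and norm $\|\cdot\|$. Let $A_1:\mathcal H\to\mathcal H$ be $\beta$-cocoercive for some $\beta>0$ (i.e. $\langle A_1x-A_1y,x-y\rangle\ge\beta\|A_1x-A_1y\|^2$ for all $x,y$), let $A_2:\mathcal H\to\mathcal H$ be maximally monotone and uniformly continuous, let $B:\mathcal H\rightrightarrows\mathcal H$ be maximally monotone, and set $A:=A_1+A_2$; $\operatorname{zer}(A+B):=\{x:0\in Ax+Bx\}$. $J_{\alpha B}:=(I+\alpha B)^{-1}$ for $\alpha>0$, and $P_C$ denotes the orthogonal projection onto a nonempty closed convex set $C$. Fix $\theta,\delta\in(0,1)$, $\bar\delta>0$ with $1-\delta-\bar\delta>0$, and $\alpha_{-1}>0$ with $\alpha_{-1}\le4\beta\bar\delta$. Conceptual Algorithm: pick $x^0\in\mathcal H$. Given $x^k$ and $\alpha_{k-1}$, for $j\in\mathbb N$ let $\bar x^k_j:=J_{\alpha_{k-1}\theta^jB}(x^k-\alpha_{k-1}\theta^jAx^k)$ and let $j(k)$ be the smallest $j\in\mathbb N$ with $\alpha_{k-1}\theta^j\langle A_2x^k-A_2\bar x^k_j,x^k-\bar x^k_j\rangle\le\delta\|x^k-\bar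 x^k_j\|^2$. Set $\alpha_k:=\alpha_{k-1}\theta^{j(k)}$, $\bar x^k:=J_{\alpha_kB}(x^k-\alpha_kAx^k)$, $r_k:=\frac{\bar\delta}{\alpha_k}\|x^k-\bar x^k\|^2$, $T_k:=\{x\in\mathcal H:\langle \frac{x^k-\bar x^k}{\alpha_k}-(A_2x^k-A_2\bar x^k),x-\bar x^k\rangle\le r_k\}$ and $\Gamma_k:=\{x\in\mathcal H:\langle x^0-x^k,x-x^k\rangle\le0\}$. Method 2 sets $x^{k+1}:=P_{T_k\cap\Gamma_k}(x^0)$ and stops if $x^{k+1}=x^k$. *)

(* Defs.v *)
From mathcomp Require Import all_boot all_order all_algebra.
From mathcomp Require Import reals.
Set Implicit Arguments. Unset Strict Implicit. Unset Printing Implicit Defensive.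
Import Order.TTheory GRing.Theory Num.Theory.
Local Open Scope ring_scope.

Section Hilbert.
Variables (R : realType) (V : lmodType R) (ip : V -> V -> R).

Definition is_inner_product : Prop :=
  [/\ (forall x y, ip x y = ip y x),
      (forall a x y z, ip (a *: x + y) z = a * ip x z + ip y z),
      (forall x, 0 <= ip x x) &
      (forall x, ip x x = 0 -> x = 0)].

Definition hnorm (x : V) : R := Num.sqrt (ip x x).

Definition hcvg (u : nat -> V) (l : V) : Prop :=
  forall eps : R, 0 < eps -> exists N, forall n, (N <= n)%N -> hnorm (u n - l) < eps.

Definition hcauchy (u : nat -> V) : Prop :=
  forall eps : R, 0 < eps -> exists N, forall n m, (N <= n)%N -> (N <= m)%N ->
    hnorm (u n - u m) < eps.

Definition hcomplete : Prop := forall u, hcauchy u -> exists l, hcvg u l.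

Definition hilbert : Prop := is_inner_product /\ hcomplete.

Definition hclosed (C : V -> Prop) : Prop :=
  forall u l, (forall n, C (u n)) -> hcvg u l -> C l.

Definition hconvex (C : V -> Prop) : Prop :=
  forall x y (t : R), C x -> C y -> 0 <= t <= 1 -> C (t *: x + (1 - t) *: y).

Definition is_proj (C : V -> Prop) (x p : V) : Prop :=
  C p /\ forall y, C y -> hnorm (x - p) <= hnorm (x - y).

Definition cocoercive (beta : R) (T : V -> V) : Prop :=
  forall x y, beta * hnorm (T x - T y) ^+ 2 <= ip (T x - T y) (x - y).

(* set-valued operators: B x u  means  u \in B x *)
Definition monotone_op (B : V -> V -> Prop) : Prop :=
  forall x y u v, B x u -> B y v -> 0 <= ip (x - y) (u - v).

Definition max_monotone_op (B : V -> V -> Prop) : Prop :=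
  monotone_op B /\
  forall x u, (forall y v, B y v -> 0 <= ip (x - y) (u - v)) -> B x u.

Definition graph (T : V -> V) : V -> V -> Prop := fun x u => u = T x.

Definition unif_continuous (T : V -> V) : Prop :=
  forall eps : R, 0 < eps -> exists d : R, 0 < d /\
    forall x y, hnorm (x - y) < d -> hnorm (T x - T y) < eps.

Definition is_resolvent (a : R) (B : V -> V -> Prop) (y z : V) : Prop :=
  exists u, B z u /\ y = z + a *: u.

Definition zer (A : V -> V) (B : V -> V -> Prop) : V -> Prop :=
  fun x => exists u, B x u /\ A x + u = 0.

(* The conceptual algorithm, Method 2.  [am1] is alpha_{-1};
   alpha k = alpha_k, jk k = j(k), xb k = \bar x^k. *)
Definition method2_run (A1 A2 : V -> V) (B : V -> V -> Prop)
  (theta delta dbar am1 : R)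
  (x : nat -> V) (alpha : nat -> R) (jk : nat -> nat) (xb : nat -> V) : Prop :=
  let A := fun v => A1 v + A2 v in
  let aprev := fun k => if k is k'.+1 then alpha k' else am1 in
  let cond := fun k (a : R) (z : V) =>
      a * ip (A2 (x k) - A2 z) (x k - z) <= delta * hnorm (x k - z) ^+ 2 in
  let T := fun k v =>
      ip ((alpha k)^-1 *: (x k - xb k) - (A2 (x k) - A2 (xb k))) (v - xb k)
        <= dbar / alpha k * hnorm (x k - xb k) ^+ 2 in
  let Gam := fun k v => ip (x 0%N - x k) (v - x k) <= 0 in
  [/\ (forall k, alpha k = aprev k * theta ^+ jk k),
      (forall k, is_resolvent (alpha k) B (x k - alpha k *: A (x k)) (xb k)),
      (forall k, cond k (alpha k) (xb k)),
      (forall k j, (j < jk k)%N -> forall z,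
          is_resolvent (aprev k * theta ^+ j) B
                       (x k - (aprev k * theta ^+ j) *: A (x k)) z ->
          ~ cond k (aprev k * theta ^+ j) z) &
      (forall k, is_proj (fun v => T k v /\ Gam k v) (x 0%N) (x k.+1))].

End Hilbert.

(* Main.v *)
Require Import Defs.
From mathcomp Require Import all_boot all_order all_algebra.
From mathcomp Require Import boolp classical_sets reals.
From mathcomp Require Import ring lra.
Import Order.TTheory GRing.Theory Num.Theory.
Local Open Scope classical_set_scope.
Local Open Scope ring_scope.
Set Implicit Arguments. Unset Strict Implicit. Unset Printing Implicit Defensive.

(** Write [Z] for [zer (A + B)].  Every half-space pair [T_k], [Gamma_k] contains [Z], so
[|x^k - x^0|] increases, stays below the distance from [x^0] to [Z], and
[|xbar - x^k|^2 <= |xbar - x^0|^2 - |x^k - x^0|^2].  It remains to see that a bound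
[|x^k - x^0| <= D] forces a zero within distance [D] of [x^0].  The steps and hence the
residuals [x^k - xb^k] tend to [0]; taking [xb^k] when the step sizes are eventually
constant, and otherwise the trial points rejected last by the line search, one finds
[e in (A + B) w] with [e] arbitrarily small and [|w - x^0|] at most [D] up to a small error.

Weak compactness is replaced by Minty's variational description
[Z = {p | <p - y, v> <= 0 for all v in (A + B) y}]: relaxing [0] to [eps_n] yields nested
closed convex sets containing approximate zeros, and near-minimizers of the distance to
[x^0] on them form a Cauchy sequence.  The same minimization, applied to
the Fitzpatrick function of [B] on [V * V], proves Minty's surjectivity theorem, which
supplies the resolvents at the rejected step sizes. *)

(** The range [eta <= 1] lets [eta] serve as a convex-combination weight and lets callers absorb
    [eta ^+ 2] into [eta]. *)
Lemma le_of_small_error (R : realFieldType) (X c M : R) :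
  (forall eta, 0 < eta <= 1 -> X <= c + eta * M) -> X <= c.
Proof.
move=> H; apply/ler_addgt0Pr => e e0.
have M1 : 0 < `|M| + 1 by rewrite ltr_wpDl.
pose eta := Num.min 1 (e / (`|M| + 1)).
have eta0 : 0 < eta <= 1.
  by rewrite /eta lt_min ltr01 divr_gt0 //= ge_min lexx.
apply: (le_trans (H _ eta0)); rewrite lerD2l.
apply: (@le_trans _ _ (eta * (`|M| + 1))).
  have := ler_norm M; have [e1 _] := andP eta0 => ?.
  by apply: ler_wpM2l; [exact: ltW | lra].
apply: (@le_trans _ _ (e / (`|M| + 1) * (`|M| + 1))).
  by apply: ler_wpM2r; [exact: ltW | rewrite /eta ge_min lexx orbT].
by rewrite divfK // gt_eqF.
Qed.

(** * Inner product geometry *)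

Section InnerProduct.
Variables (R : realType) (V : lmodType R) (ip : V -> V -> R).
Hypothesis ipP : is_inner_product ip.
Implicit Types x y z : V.
Local Notation norm := (hnorm ip).

Lemma ipC x y : ip x y = ip y x.
Proof. by case: ipP. Qed.

Lemma ipDl x y z : ip (x + y) z = ip x z + ip y z.
Proof. by case: ipP => _ H _ _; rewrite -[x in LHS]scale1r H mul1r. Qed.

Lemma ip0l y : ip 0 y = 0.
Proof. by apply: (@addrI _ (ip 0 y)); rewrite -ipDl !addr0. Qed.

Lemma ipZl a x y : ip (a *: x) y = a * ip x y.
Proof. by case: ipP => _ H _ _; rewrite -[a *: x]addr0 H ip0l addr0. Qed.

Lemma ipNl x y : ip (- x) y = - ip x y.
Proof. by rewrite -scaleN1r ipZl mulN1r. Qed.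

Lemma ipDr x y z : ip z (x + y) = ip z x + ip z y.
Proof. by rewrite ipC ipDl !(ipC _ z). Qed.

Lemma ip0r y : ip y 0 = 0. Proof. by rewrite ipC ip0l. Qed.

Lemma ipZr a x y : ip y (a *: x) = a * ip y x.
Proof. by rewrite ipC ipZl ipC. Qed.

Lemma ipNr x y : ip y (- x) = - ip y x.
Proof. by rewrite ipC ipNl ipC. Qed.

Definition ipE := (ipDl, ipDr, ipNl, ipNr, ipZl, ipZr, ip0l, ip0r).

Lemma ip_ge0 x : 0 <= ip x x. Proof. by case: ipP. Qed.

Lemma ip_eq0 x : ip x x = 0 -> x = 0. Proof. by case: ipP => _ _ _; apply. Qed.

Lemma hnorm_ge0 x : 0 <= norm x. Proof. exact: sqrtr_ge0. Qed.

Lemma sqr_hnorm x : norm x ^+ 2 = ip x x.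
Proof. by rewrite sqr_sqrtr // ip_ge0. Qed.

Lemma hnormZ a x : norm (a *: x) = `|a| * norm x.
Proof. by rewrite /hnorm !ipE mulrA -expr2 sqrtrM ?sqr_ge0 // sqrtr_sqr. Qed.

Lemma hnormN x : norm (- x) = norm x.
Proof. by rewrite /hnorm !ipE opprK. Qed.

Lemma hdistC x y : norm (x - y) = norm (y - x).
Proof. by rewrite -hnormN opprB. Qed.

Lemma cauchy_schwarz x y : ip x y <= norm x * norm y.
Proof.
have nx := hnorm_ge0 x; have ny := hnorm_ge0 y.
have : ip x y ^+ 2 <= (norm x * norm y) ^+ 2.
  rewrite exprMn !sqr_hnorm.
  have [y0|yN0] := eqVneq (ip y y) 0.
    by rewrite (ip_eq0 y0) !ipE expr2 !mulr0.
  have y0 : 0 < ip y y by rewrite lt_def yN0 ip_ge0.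
  (* This is the component of [x] orthogonal to [y], scaled by [ip y y] to avoid a division. *)
  have := ip_ge0 (ip y y *: x - ip x y *: y); rewrite !ipE (ipC y x) => H.
  rewrite -(ler_pM2l y0); nra.
have : 0 <= norm x * norm y by exact: mulr_ge0.
nra.
Qed.

Lemma ler_norm_ip x y : `|ip x y| <= norm x * norm y.
Proof.
rewrite ler_norml cauchy_schwarz andbT.
by rewrite -(hnormN x) lerNl -ipNl cauchy_schwarz.
Qed.

Lemma ler_hnormD x y : norm (x + y) <= norm x + norm y.
Proof.
have nx := hnorm_ge0 x; have ny := hnorm_ge0 y; have n := hnorm_ge0 (x + y).
have := sqr_hnorm (x + y); rewrite !ipE (ipC y x) -!sqr_hnorm => E.
have := cauchy_schwarz x y; nra.
Qed.

Lemma ler_hnorm_distD z x y : norm (x - y) <= norm (x - z) + norm (z - y).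
Proof. by rewrite -[x - y](subrKA z) ler_hnormD. Qed.

(** An arbitrary intersection of closed half-spaces of [V * R], so convexity and closedness come for
    free. The extra coordinate [r] makes room for epigraphs. *)
Definition polyhedron (F : V -> R -> R -> Prop) (x : V) (r : R) : Prop :=
  forall b s c, F b s c -> ip x b + s * r <= c.

Lemma polyhedron_convex F x y r s t : 0 <= t <= 1 ->
  polyhedron F x r -> polyhedron F y s ->
  polyhedron F (t *: x + (1 - t) *: y) (t * r + (1 - t) * s).
Proof.
move=> /andP[t0 t1] Hx Hy b k c Hc; have Ex := Hx _ _ _ Hc.
have Ey := Hy _ _ _ Hc; rewrite !ipE; nra.
Qed.

(** Compare [p] with the points [t *: y + (1 - t) *: p] of [C], divide by [t] and let [t] tend to
    0. *)
Lemma proj_variational C x p y : hconvex C -> is_proj ip C x p -> C y ->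
  ip (x - p) (y - p) <= 0.
Proof.
move=> cC [Cp Hp] Cy.
rewrite -(ler_pM2l (ltr0n R 2)) mulr0.
apply: (@le_of_small_error _ _ _ (ip (y - p) (y - p))) => t /andP[t0 t1].
have Ct : C (t *: y + (1 - t) *: p) by apply: cC => //; rewrite (ltW t0).
have := Hp _ Ct; have n1 := hnorm_ge0 (x - p) => L.
have : norm (x - p) ^+ 2 <= norm (x - (t *: y + (1 - t) *: p)) ^+ 2 by nra.
rewrite !sqr_hnorm !ipE (ipC y x) (ipC p x) (ipC p y) => H.
rewrite -(ler_pM2l t0); lra.
Qed.

End InnerProduct.

(** * Limits of real sequences *)

Lemma inv_nat_eventually_lt (R : realType) (e : R) : 0 < e ->
  exists N, forall n, (N <= n)%N -> n.+1%:R^-1 < e.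
Proof.
move=> e0; exists (Num.bound e^-1) => n nN.
have := archi_boundP (ltW (_ : 0 < e^-1)); rewrite invr_gt0 => /(_ e0) H.
rewrite invf_plt ?posrE ?ltr0n //; apply: (lt_trans H).
by rewrite ltr_nat ltnS.
Qed.

Lemma nondecreasing_bounded_limit (R : realType) (s : nat -> R) (D : R) :
  (forall n, s n <= s n.+1) -> (forall n, s n <= D) ->
  exists l, (forall n, s n <= l) /\
    forall e, 0 < e -> exists N, forall n, (N <= n)%N -> l - e < s n.
Proof.
move=> ms bs.
have mono n m : (n <= m)%N -> s n <= s m.
  by move=> /subnK <-; elim: (m - n)%N => // k /le_trans; apply; rewrite addSn.
have hs : has_sup (range s).
  by split; [exists (s 0%N), 0%N | exists D => _ [n _ <-]].
exists (sup (range s)); split; first by move=> n; apply: ub_le_sup; [case: hs|exists n].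
move=> e e0; have [_ [N _ <-] HN] := sup_adherent e0 hs.
by exists N => n /mono; apply: lt_le_trans.
Qed.

(** * Minimization over nested closed convex sets *)

Section Minimization.
Variables (R : realType) (V : lmodType R) (ip : V -> V -> R).
Hypothesis hV : hilbert ip.
Let ipP : is_inner_product ip := proj1 hV.
Local Notation norm := (hnorm ip).

(** The infima [inf (G n)] increase to some [d]. Near-minimizers [q n] are Cauchy by the
    parallelogram identity, and their limit satisfies every inequality of every level. *)
Lemma nested_polyhedra_minimizer (F : nat -> V -> R -> R -> Prop) (a : V) (D : R) :
  (forall n x r, polyhedron ip (F n.+1) x r -> polyhedron ip (F n) x r) ->
  (forall n, exists x r, polyhedron ip (F n) x r /\ r + ip (x - a) (x - a) <= D) ->
  (forall n x r, polyhedron ip (F n) x r -> 0 <= r + ip (x - a) (x - a)) ->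
  exists x r, (forall n, polyhedron ip (F n) x r) /\
    forall c, (forall n, exists y s,
        polyhedron ip (F n) y s /\ s + ip (y - a) (y - a) <= c) ->
      r + ip (x - a) (x - a) <= c.
Proof.
move=> nF bF F0.
have nF' n m x r : (n <= m)%N -> polyhedron ip (F m) x r -> polyhedron ip (F n) x r.
  by move=> /subnK <-; elim: (m - n)%N => // k IH; rewrite addSn => /nF.
pose G n : set R := [set g | exists x r,
  polyhedron ip (F n) x r /\ g = r + ip (x - a) (x - a)].
have hG n : has_inf (G n).
  split; first by have [x [r [H _]]] := bF n; exists (r + ip (x - a) (x - a)), x, r.
  by exists 0 => _ [x [r [H ->]]]; exact: F0 H.
have lG n g : G n g -> inf (G n) <= g by move=> ?; apply: ge_inf => //; case: (hG n).
have [d [dle dlim]] : exists l, (forall n, inf (G n) <= l) /\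
    forall e, 0 < e -> exists N, forall n, (N <= n)%N -> l - e < inf (G n).
  apply: nondecreasing_bounded_limit => n.
    apply: lb_le_inf; first by case: (hG n.+1).
    by move=> _ [x [r [H ->]]]; apply: lG; exists x, r; split => //; apply: nF.
  have [x [r [H le]]] := bF n.
  by apply: le_trans le; apply: lG; exists x, r.
have ex n : exists xr : V * R, polyhedron ip (F n) xr.1 xr.2 /\
    xr.2 + ip (xr.1 - a) (xr.1 - a) < inf (G n) + n.+1%:R^-1.
  have n0 : 0 < n.+1%:R^-1 :> R by rewrite invr_gt0 ltr0n.
  by have [_ [x [r [H ->]]] lt] := inf_adherent n0 (hG n); exists (x, r).
have [qr /all_and2[qrF qrlt]] := choice ex.
pose q n := (qr n).1; pose g n := (qr n).2 + ip (q n - a) (q n - a).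
have gd n : g n < d + n.+1%:R^-1.
  by apply: lt_le_trans (qrlt n) _; rewrite lerD2r.
have Ggn n m : (n <= m)%N -> inf (G n) <= g m.
  by move=> nm; apply: lG; exists (q m), (qr m).2; split => //; apply: nF' nm _.
have qq N n m : (N <= n)%N -> (N <= m)%N -> ip (q n - q m) (q n - q m) <=
    2 * (g n + g m) - 4 * inf (G N).
  move=> Nn Nm.
  (* The midpoint of two points of level [N] stays in level [N], so its value is at least
     [inf (G N)]; the parallelogram identity does the rest. *)
  have half : 0 <= (2^-1 : R) <= 1 by lra.
  have := @polyhedron_convex _ _ _ ipP _ _ _ _ _ _ half (nF' _ _ _ _ Nn (qrF n)) (nF' _ _ _ _ Nm (qrF m)).
  set x := (X in polyhedron _ _ X _); set r := (X in polyhedron _ _ _ X) => H.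
  have : inf (G N) <= r + ip (x - a) (x - a) by apply: lG; exists x, r.
  rewrite /x /r /g -/(q n) -/(q m) !(ipE ipP).
  rewrite (ipC ipP (q m) (q n)) (ipC ipP a (q n)) (ipC ipP a (q m)); lra.
have cq : hcauchy ip q.
  move=> e e0.
  (* With all three values within [e ^+ 2 / 8] of [d], the bound [qq] is 4 (e^2 / 8) + 4 (e^2 / 8) =
     e^2. *)
  have e2 : 0 < e ^+ 2 / 8 by rewrite divr_gt0 ?exprn_gt0.
  have [N1 HN1] := dlim _ e2; have [N2 HN2] := inv_nat_eventually_lt e2.
  exists (maxn N1 N2) => n m.
  rewrite !geq_max => /andP[n1 n2] /andP[m1 m2].
  have gn : g n < d + e ^+ 2 / 8 by apply: lt_trans (gd n) _; rewrite ltrD2l HN2.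
  have gm : g m < d + e ^+ 2 / 8 by apply: lt_trans (gd m) _; rewrite ltrD2l HN2.
  have := qq _ _ _ n1 m1; have := HN1 _ (leqnn _); rewrite -(sqr_hnorm ipP) => *.
  have : norm (q n - q m) ^+ 2 < e ^+ 2 by lra.
  by have := hnorm_ge0 ip (q n - q m); nra.
have [x qx] := (proj2 hV) _ cq.
(* The only possible limit of the heights [(qr n).2], since [g n] tends to [d] and [q n] to [x]. *)
exists x, (d - ip (x - a) (x - a)); split; last first.
  move=> c Hc; rewrite subrK; apply/ler_addgt0Pr => e e0.
  have [N HN] := dlim _ e0; have := HN _ (leqnn _).
  have [y [s [H le]]] := Hc N.
  have : inf (G N) <= s + ip (y - a) (y - a) by apply: lG; exists y, s.
  by lra.
move=> n b s c Fc.
(* Replacing [x] by [q m] costs [e * norm b]; replacing the height costs [e] from [g m], and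
   [e ^+ 2 + 2 * e * norm (x - a)] from the square, with [e <= 1]. *)
pose M := norm b + `|s| * (2 + 2 * norm (x - a)).
apply: (@le_of_small_error _ _ _ M) => e /andP[e0 e1].
have [N1 HN1] := qx _ e0; have [N2 HN2] := dlim _ e0.
have [N3 HN3] := inv_nat_eventually_lt e0.
pose m := maxn n (maxn N1 (maxn N2 N3)).
have [mn m1 m2 m3] : [/\ (n <= m)%N, (N1 <= m)%N, (N2 <= m)%N & (N3 <= m)%N].
  by rewrite /m !leq_max !leqnn !orbT.
have := nF' _ _ _ _ mn (qrF m) _ _ _ Fc; rewrite -/(q m) => Hm.
have hb := hnorm_ge0 ip b; have hx := hnorm_ge0 ip (x - a).
have hq := hnorm_ge0 ip (q m - x); have ltq := HN1 _ m1.
have : ip (x - q m) b <= e * norm b.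
  apply: (le_trans (cauchy_schwarz ipP _ _)); rewrite (hdistC ipP); nra.
have : `|d - ip (x - a) (x - a) - (qr m).2| <= e * (2 + 2 * norm (x - a)).
  have -> : (qr m).2 = g m - ip (q m - a) (q m - a) by rewrite /g addrK.
  have E : ip (q m - a) (q m - a) - ip (x - a) (x - a)
      = ip (q m - x) (q m - x) + 2 * ip (q m - x) (x - a).
    rewrite !(ipE ipP) (ipC ipP a (q m)) (ipC ipP a x) (ipC ipP x (q m)); ring.
  have := ler_norm_ip ipP (q m - x) (x - a); rewrite !ler_norml => /andP[c1 c2].
  have E2 := sqr_hnorm ipP (q m - x).
  have gm : g m < d + e by apply: lt_trans (gd m) _; rewrite ltrD2l HN3.
  have := HN2 _ m2; have := Ggn m m (leqnn _).
  move=> *; apply/andP; split; nra.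
move=> L1 L2.
have : s * (d - ip (x - a) (x - a) - (qr m).2) <= `|s| * (e * (2 + 2 * norm (x - a))).
  by apply: le_trans (ler_norm _) _; rewrite normrM ler_wpM2l.
rewrite /M; move: L2; rewrite (ipDl ipP) (ipNl ipP); lra.
Qed.

End Minimization.

(** * The product Hilbert space *)

Section Product.
Variables (R : realType) (V : lmodType R) (ip : V -> V -> R).
Hypothesis hV : hilbert ip.
Let ipP : is_inner_product ip := proj1 hV.

Definition ip_prod (p q : V * V) : R := ip p.1 q.1 + ip p.2 q.2.

Lemma ip_prodP : is_inner_product ip_prod.
Proof.
split=> [p q|a p q r|p|[p1 p2]]; rewrite /ip_prod /=.
- by rewrite (ipC ipP p.1) (ipC ipP p.2).
- rewrite !(ipE ipP); ring.
- by rewrite addr_ge0 ?(ip_ge0 ipP).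
move=> E; have h1 := ip_ge0 ipP p1; have h2 := ip_ge0 ipP p2.
have E1 : p1 = 0 by apply: (ip_eq0 ipP); lra.
have E2 : p2 = 0 by apply: (ip_eq0 ipP); lra.
by rewrite E1 E2.
Qed.

Lemma hnorm_prod_ge p : hnorm ip p.1 <= hnorm ip_prod p /\ hnorm ip p.2 <= hnorm ip_prod p.
Proof.
by split; rewrite ler_wsqrtr // /ip_prod ?lerDl ?lerDr (ip_ge0 ipP).
Qed.

Lemma hnorm_prod_le p : hnorm ip_prod p <= hnorm ip p.1 + hnorm ip p.2.
Proof.
have h1 := hnorm_ge0 ip p.1; have h2 := hnorm_ge0 ip p.2.
have := sqr_hnorm ip_prodP p; rewrite /ip_prod -!(sqr_hnorm ipP).
have := hnorm_ge0 ip_prod p; nra.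
Qed.

Lemma hilbert_prod : hilbert ip_prod.
Proof.
split; first exact: ip_prodP.
move=> u cu.
have [l1 H1] : exists l, hcvg ip (fun n => (u n).1) l.
  apply: (proj2 hV) => e /cu[N HN]; exists N => n m nN mN.
  by apply: le_lt_trans (HN n m nN mN); exact: (proj1 (hnorm_prod_ge (u n - u m))).
have [l2 H2] : exists l, hcvg ip (fun n => (u n).2) l.
  apply: (proj2 hV) => e /cu[N HN]; exists N => n m nN mN.
  by apply: le_lt_trans (HN n m nN mN); exact: (proj2 (hnorm_prod_ge (u n - u m))).
exists (l1, l2) => e e0; have e2 : 0 < e / 2 by rewrite divr_gt0.
have [[N1 HN1] [N2 HN2]] := (H1 _ e2, H2 _ e2); exists (maxn N1 N2) => n.
rewrite geq_max => /andP[/HN1 h1 /HN2 h2].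
by apply: (le_lt_trans (hnorm_prod_le _)) => /=; lra.
Qed.

End Product.

(** * Minty's surjectivity theorem *)

Section Minty.
Variables (R : realType) (V : lmodType R) (ip : V -> V -> R).
Hypothesis hV : hilbert ip.
Let ipP : is_inner_product ip := proj1 hV.
Implicit Type B : V -> V -> Prop.

(* [polyhedron (fitzpatrick B)] is the epigraph of twice the Fitzpatrick function
   (x, u) |-> sup_(y, v in gra B) <x, v> + <y, u> - <y, v>. *)
Definition fitzpatrick B : V * V -> R -> R -> Prop := fun b s c =>
  exists y v, B y v /\ [/\ b = (v, y), s = - 2^-1 & c = ip y v].

(** If the bound failed, [p] would be monotonically related to the whole graph, hence in it by
    maximality, and its own inequality would then give the bound. *)
Lemma fitzpatrick_ge B p r : max_monotone_op ip B ->
  polyhedron (ip_prod ip) (fitzpatrick B) p r -> 2 * ip p.1 p.2 <= r.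
Proof.
move=> [_ mB] Hp; have H y v : B y v -> ip p.1 v + ip y p.2 - ip y v <= r / 2.
  move=> Byv; have /Hp : fitzpatrick B (v, y) (- 2^-1) (ip y v) by exists y, v.
  by rewrite /ip_prod /= (ipC ipP p.2); lra.
have [//|lt] := leP (2 * ip p.1 p.2) r.
have Bp : B p.1 p.2.
  by apply: mB => y v /H; rewrite !(ipE ipP); lra.
by have := H _ _ Bp; lra.
Qed.

Lemma fitzpatrick_graph B y v : monotone_op ip B -> B y v ->
  polyhedron (ip_prod ip) (fitzpatrick B) (y, v) (2 * ip y v).
Proof.
move=> mB Byv _ _ _ [y' [v' [B' [-> -> ->]]]]; rewrite /ip_prod /=.
by have := mB _ _ _ _ Byv B'; rewrite !(ipE ipP) (ipC ipP v y'); lra.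
Qed.

(** Minimize twice the Fitzpatrick function plus the squared norm. Optimality at [(x, u)] and
    [fitzpatrick_ge] put [(- u, - x)] in the graph; testing optimality at that very point forces
    [x + u = 0]. *)
Lemma minty0 B : max_monotone_op ip B -> exists x, B x (- x).
Proof.
move=> mB.
have [y0 [v0 B0]] : exists y v, B y v.
  (* An empty graph is not maximal: any pair is vacuously related to it. *)
  apply: contrapT => H; apply: (H); exists 0, 0; apply: (proj2 mB) => y v Byv.
  by case: H; exists y, v.
have [//|z|_ z r H|[x u] [r [Hz Hmin]]] := @nested_polyhedra_minimizer R _ (ip_prod ip)
  (hilbert_prod hV) (fun=> fitzpatrick B) 0 (2 * ip y0 v0 + ip_prod ip (y0, v0) (y0, v0)).
- by exists (y0, v0), (2 * ip y0 v0); split; [exact: fitzpatrick_graph (proj1 mB) B0 | rewrite subr0].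
- have := fitzpatrick_ge mB H; rewrite subr0 /ip_prod.
  by have := ip_ge0 ipP (z.1 + z.2); rewrite !(ipE ipP) (ipC ipP z.2 z.1); lra.
have {Hz} Hz := Hz 0%N; have r_ge := fitzpatrick_ge mB Hz; rewrite /= in r_ge.
(* First-order optimality of the minimizer (x, u) of [F + |.|^2 / 2], tested
   against the points of the graph, where [F (y, v) = <y, v>]. *)
have first_order y v : B y v -> 0 <= 2 * ip y v - r + 2 * (ip x (y - x) + ip u (v - u)).
  move=> Byv; rewrite -oppr_le0.
  pose q := (y - x, v - u).
  apply: (@le_of_small_error _ _ _ (ip_prod ip q q)) => t /andP[t0 t1].
  have t01 : 0 <= t <= 1 by rewrite ltW.
  have := @polyhedron_convex _ _ _ (ip_prodP hV) _ _ _ _ _ _ t01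
    (fitzpatrick_graph (proj1 mB) Byv) Hz.
  set z := (X in polyhedron _ _ X _); set s := (X in polyhedron _ _ _ X) => Hs.
  have := Hmin (s + ip_prod ip (z - 0) (z - 0)) (fun=> ex_intro _ z (ex_intro _ s (conj Hs (lexx _)))).
  rewrite !subr0 /z /s /q /ip_prod /= !(ipE ipP).
  rewrite (ipC ipP y x) (ipC ipP v u) => L; rewrite -(ler_pM2l t0); lra.
have Bux : B (- u) (- x).
  apply: (proj2 mB) => y v /first_order.
  have := ip_ge0 ipP (x + u); rewrite !(ipE ipP) (ipC ipP u x) (ipC ipP y x) (ipC ipP u v).
  by rewrite (ipC ipP v u); lra.
have xu : x + u = 0.
  apply: (ip_eq0 ipP); have := first_order _ _ Bux; have := ip_ge0 ipP (x + u).
  by rewrite !(ipE ipP) (ipC ipP u x); lra.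
by exists x; move/eqP: xu; rewrite addrC addr_eq0 => /eqP uE; rewrite uE opprK in Bux.
Qed.

(** Reduces to [minty0] for the translated and scaled operator x |-> a B(x + y), again maximally
    monotone. *)
Lemma minty B a y : max_monotone_op ip B -> 0 < a -> exists z, is_resolvent a B y z.
Proof.
move=> [mB MB] a0; have aN0 : a != 0 by rewrite gt_eqF.
have ip_scale x u v : ip x (a^-1 *: u - a^-1 *: v) = a^-1 * ip x (u - v).
  by rewrite -scalerBr (ipZr ipP).
have ia0 : 0 < a^-1 by rewrite invr_gt0.
have [|x Bx] := @minty0 (fun x u => B (x + y) (a^-1 *: u)).
  split=> [x x' u u' /mB H /H|x u H].
    by rewrite ip_scale opprD addrACA subrr addr0 pmulr_rge0.
  apply: MB => z v Bzv; have := H (z - y) (a *: v).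
  rewrite subrK scalerA mulVf // scale1r => /(_ Bzv) L.
  rewrite -(pmulr_rge0 _ a0) -(ipZr ipP) scalerBr scalerA mulfV // scale1r.
  by move: L; rewrite opprB addrA (addrAC x).
exists (x + y), (a^-1 *: (- x)); split => //.
by rewrite scalerA mulfV // scale1r addrAC subrr add0r.
Qed.

End Minty.

(** * Zeros of [A + B] and approximate zeros *)

Section MonotoneInclusion.
Variables (R : realType) (V : lmodType R) (ip : V -> V -> R).
Hypothesis hV : hilbert ip.
Let ipP : is_inner_product ip := proj1 hV.
Local Notation norm := (hnorm ip).
Implicit Types (A T : V -> V) (B : V -> V -> Prop).

Lemma cocoercive_lipschitz beta T x y : 0 < beta -> cocoercive ip beta T ->
  norm (T x - T y) <= norm (x - y) / beta.
Proof.
move=> b0 cT; rewrite ler_pdivlMr //.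
have := le_trans (cT x y) (cauchy_schwarz ipP _ _).
have := hnorm_ge0 ip (T x - T y); have := hnorm_ge0 ip (x - y).
set h := norm _; set k := norm _ => h0 k0 L.
have [k_eq0|k_neq0] := eqVneq k 0; first by rewrite k_eq0 mul0r.
have k_gt0 : 0 < k by rewrite lt_def k_neq0.
by rewrite -(ler_pM2l k_gt0); lra.
Qed.

Lemma cocoercive_unif_continuous beta T : 0 < beta -> cocoercive ip beta T ->
  unif_continuous ip T.
Proof.
move=> b0 cT e e0; exists (e * beta); split; first exact: mulr_gt0.
move=> x y lt; apply: le_lt_trans (cocoercive_lipschitz _ _ b0 cT) _.
by rewrite ltr_pdivrMr.
Qed.

Lemma unif_continuousD T T' : unif_continuous ip T -> unif_continuous ip T' ->
  unif_continuous ip (fun v => T v + T' v).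
Proof.
move=> cT cT' e e0; have e2 : 0 < e / 2 by rewrite divr_gt0.
have [[d [d0 Hd]] [d' [d'0 Hd']]] := (cT _ e2, cT' _ e2).
exists (Num.min d d'); split; first by rewrite lt_min d0.
move=> x y; rewrite lt_min => /andP[/Hd h /Hd' h'].
have -> : T x + T' x - (T y + T' y) = (T x - T y) + (T' x - T' y).
  by rewrite opprD addrACA.
by apply: (le_lt_trans (ler_hnormD ipP _ _)); lra.
Qed.

(** Cut the segment from [x] to [y] into pieces shorter than [d]; [T] moves by at most 1 along each,
    and about [norm (x - y) / d] pieces suffice. *)
Lemma unif_continuous_affine_bound T : unif_continuous ip T ->
  exists C, 0 < C /\ forall x y, norm (T x - T y) <= C * (1 + norm (x - y)).
Proof.
move=> cT; have [d [d0 Hd]] := cT 1 ltr01.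
have chain n x y : norm (x - y) < n.+1%:R * d -> norm (T x - T y) <= n.+1%:R.
  elim: n x y => [|n IH] x y; first by rewrite mul1r => /Hd/ltW.
  move=> lt; pose t : R := n.+2%:R^-1; have n0 : 0 < n.+2%:R :> R by rewrite ltr0n.
  have t0 : 0 < t by rewrite invr_gt0.
  have tn : t * n.+2%:R = 1 by rewrite mulVf ?gt_eqF.
  have nS : n.+2%:R = n.+1%:R + 1 :> R by rewrite -(natrD _ _ 1) addn1.
  have n1 : 0 <= n.+1%:R :> R by exact: ler0n.
  pose z := x - t *: (x - y).
  have xz : norm (x - z) < d.
    rewrite /z opprB addrC subrK (hnormZ ipP) gtr0_norm //.
    by rewrite -(ltr_pM2l n0) mulrA (mulrC _ t) tn mul1r.
  have zy : norm (z - y) < n.+1%:R * d.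
    have -> : z - y = (1 - t) *: (x - y) by rewrite /z scalerBl scale1r addrAC.
    rewrite (hnormZ ipP) ger0_norm; last first.
      by rewrite subr_ge0 invf_le1 // (ler_nat _ 1).
    rewrite -(ltr_pM2l n0) mulrA mulrBr mulr1 (mulrC _ t) tn nS addrK.
    by rewrite -nS mulrCA ltr_pM2l ?ltr0n.
  apply: le_trans (ler_hnorm_distD ipP (T z) _ _) _; rewrite nS.
  by have := IH _ _ zy; have := ltW (Hd _ _ xz); lra.
have id0 : 0 < d^-1 by rewrite invr_gt0.
exists (1 + d^-1); split => [|x y]; first by lra.
have h0 := hnorm_ge0 ip (x - y); set h := norm (x - y) in h0 *.
have hd : 0 <= h / d by rewrite divr_ge0 // ltW.
have /andP[le lt] := truncn_itv hd.
have : norm (T x - T y) <= (Num.trunc (h / d)).+1%:R.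
  by apply: chain; rewrite -ltr_pdivrMr.
move=> L; apply: (le_trans L); rewrite -addn1 natrD; nra.
Qed.

(** Let [z] be the resolvent of [p - t *: A p] and [e] the quotient (p - z) / t. The hypothesis at
    [z] gives [norm e <= norm (A p - A z)], so [z] tends to [p] and [e] to 0 with [t]. Monotonicity
    of [B] between [z] and [y] then passes to the limit, and maximality concludes. *)
Lemma zer_of_minty A B p : unif_continuous ip A -> max_monotone_op ip B ->
  (forall y u, B y u -> ip (p - y) (A y + u) <= 0) -> zer A B p.
Proof.
move=> cA mB Hp; have [C [C0 HC]] := unif_continuous_affine_bound cA.
exists (- A p); split; last exact: subrr.
apply: (proj2 mB) => y u Byu; rewrite -oppr_le0.
apply: (@le_of_small_error _ _ _ (norm (- A p - u) + 1 + norm (p - y))).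
move=> eta /andP[eta0 eta1]; have [d [d0 Hd]] := cA _ eta0.
pose m := Num.min d eta.
have [m0 md me] : [/\ 0 < m, m <= d & m <= eta].
  by rewrite /m lt_min d0 eta0 !ge_min !lexx orbT.
(* The affine bound gives [norm (p - z) <= m / 3 * (1 + norm (p - z))]; as [m <= 1], this yields at
   most [m / 2]. *)
pose t := m / (3 * C).
have t0 : 0 < t by rewrite divr_gt0 // mulr_gt0.
have tC : t * C = m / 3 by rewrite /t; field; rewrite gt_eqF.
have tN0 : t != 0 by rewrite gt_eqF.
have [z [w [Bzw E]]] := minty hV (p - t *: A p) mB t0.
pose e := t^-1 *: (p - z).
have wE : w = e - A p.
  apply: (scalerI tN0); rewrite scalerBr scalerA mulfV // scale1r.
  by rewrite addrAC E addrAC subrr add0r.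
have te : p - z = t *: e by rewrite scalerA mulfV // scale1r.
have h0 := hnorm_ge0 ip (p - z); have e0 := hnorm_ge0 ip e.
have hte : norm (p - z) = t * norm e by rewrite te (hnormZ ipP) gtr0_norm.
have le_eA : norm e <= norm (A p - A z).
  have := Hp _ _ Bzw; rewrite te wE (ipZl ipP) pmulr_rle0 //.
  have -> : A z + (e - A p) = e - (A p - A z) by rewrite opprB addrCA.
  rewrite (ipDr ipP) (ipNr ipP) -(sqr_hnorm ipP).
  by have := cauchy_schwarz ipP e (A p - A z); have := hnorm_ge0 ip (A p - A z); nra.
have hm : norm (p - z) < m.
  have : norm (p - z) <= m / 3 * (1 + norm (p - z)).
    by rewrite {1}hte -tC -mulrA ler_pM2l // (le_trans le_eA).
  nra.
have eeta : norm e < eta.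
  by apply: le_lt_trans le_eA _; apply: Hd; apply: lt_le_trans hm _.
have := proj1 mB _ _ _ _ Bzw Byu; rewrite wE => mono.
have c1 := cauchy_schwarz ipP (p - z) (A p + u).
have nE : norm (- A p - u) = norm (A p + u) by rewrite -opprD (hnormN ipP).
have c2 := cauchy_schwarz ipP (z - y) e.
have n1 := hnorm_ge0 ip (A p + u); have n2 := hnorm_ge0 ip (p - y).
have n3 : norm (z - y) <= eta + norm (p - y).
  apply: le_trans (ler_hnorm_distD ipP p _ _) _; rewrite (hdistC ipP z); lra.
have n4 := hnorm_ge0 ip (z - y).
have -> : - ip (p - y) (- A p - u) =
    ip (p - z) (A p + u) + ip (z - y) e - ip (z - y) (e - A p - u).
  rewrite !(ipE ipP); ring.
rewrite nE; nra.
Qed.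

Lemma zer_of_approx_zer A B a D : (forall x y, 0 <= ip (A x - A y) (x - y)) ->
  unif_continuous ip A -> max_monotone_op ip B ->
  (forall eps, 0 < eps ->
    exists w e, [/\ B w (e - A w), norm e <= eps & norm (w - a) <= D + eps]) ->
  exists p, zer A B p /\ norm (p - a) <= D.
Proof.
move=> mA cA mB Happ.
have nN n : 0 < n.+1%:R^-1 :> R by rewrite invr_gt0 ltr0n.
have nN1 n : n.+1%:R^-1 <= 1 :> R by rewrite invf_le1 ?ltr0n // (ler_nat _ 1).
have D1 y : 0 <= D + 1 + norm (y - a).
  have [w [e [_ _ H]]] := Happ _ ltr01; have := hnorm_ge0 ip (y - a).
  by have := hnorm_ge0 ip (w - a); lra.
(* The alternative [b = 0 /\ c = 0], with [s] arbitrary, forces [r = 0]. *)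
pose F n (b : V) (s c : R) := (b = 0 /\ c = 0) \/ exists y u,
  [/\ B y u, b = A y + u, s = 0 &
      c = ip y (A y + u) + (D + 1 + norm (y - a)) * n.+1%:R^-1].
(* The tolerance is weighted by [D + 1 + norm (y - a)], which bounds [norm (w - y)] for every
   approximate zero [w] within [D + 1] of [a]. *)
pose K n p := forall y u, B y u ->
  ip (p - y) (A y + u) <= (D + 1 + norm (y - a)) * n.+1%:R^-1.
have FP n p r : polyhedron ip (F n) p r <-> r = 0 /\ K n p.
  split=> [H|[-> H] b s c [[-> ->]|[y [u [Byu -> -> ->]]]]]; first split.
  - have := H 0 1 0 (or_introl (conj erefl erefl)).
    have := H 0 (- 1) 0 (or_introl (conj erefl erefl)).
    by rewrite (ip0r ipP); lra.
  - move=> y u Byu.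
    have /H : F n (A y + u) 0 (ip y (A y + u) + (D + 1 + norm (y - a)) * n.+1%:R^-1).
      by right; exists y, u.
    by rewrite mul0r addr0 (ipDl ipP) (ipNl ipP) lerBlDl.
  - by rewrite (ip0r ipP) mulr0 addr0.
  - have := H _ _ Byu.
    by rewrite mul0r addr0 (ipDl ipP) (ipNl ipP) lerBlDl.
have near n eta : 0 < eta -> exists w, K n w /\ norm (w - a) <= D + eta.
  move=> eta0.
  have e0 : 0 < Num.min eta n.+1%:R^-1 by rewrite lt_min eta0 nN.
  have [w [e [Bw]]] := Happ _ e0; set m := Num.min _ _ in e0 * => He Hw.
  have m1 : m <= eta by rewrite /m ge_min lexx.
  have m2 : m <= n.+1%:R^-1 by rewrite /m ge_min lexx orbT.
  exists w; split; last by lra.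
  move=> y u Byu; have := proj1 mB _ _ _ _ Bw Byu; have := mA w y.
  have -> : ip (w - y) (e - A w - u) =
     ip (w - y) e - ip (A w - A y) (w - y) - ip (w - y) (A y + u).
    by rewrite (ipC ipP (A w - A y)) !(ipE ipP); ring.
  have := cauchy_schwarz ipP (w - y) e.
  have := hnorm_ge0 ip (w - y); have := hnorm_ge0 ip e.
  have : norm (w - y) <= D + 1 + norm (y - a).
    apply: le_trans (ler_hnorm_distD ipP a _ _) _; rewrite (hdistC ipP a).
    by have := nN1 n; move: m2 Hw; set q := n.+1%:R^-1; lra.
  move: He m2 (nN n) (D1 y); set q := n.+1%:R^-1; set k := D + 1 + _ => *.
  have : norm (w - y) * norm e <= k * q by apply: ler_pM => //; lra.
  lra.
have near_sqr n eta : 0 < eta -> exists x r,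
    polyhedron ip (F n) x r /\ r + ip (x - a) (x - a) <= (D + eta) ^+ 2.
  move=> eta0; have [w [Kw le]] := near n _ eta0.
  exists w, 0; split; first by apply/FP.
  by rewrite add0r -(sqr_hnorm ipP); have := hnorm_ge0 ip (w - a); nra.
have [|n||p [r [/(_ _)/FP Hp Hmin]]] :=
  @nested_polyhedra_minimizer _ _ ip hV F a ((D + 1) ^+ 2).
- move=> n x r /FP[-> Kx]; apply/FP; split=> // y u /Kx L; apply: (le_trans L).
  by rewrite ler_wpM2l // lef_pV2 ?posrE ?ltr0n // ler_nat.
- exact: near_sqr.
- by move=> n x r /FP[-> _]; rewrite add0r (ip_ge0 ipP).
have r0 : r = 0 by case: (Hp 0%N).
exists p; split.
  apply: zer_of_minty => // y u Byu.
  apply: (@le_of_small_error _ _ _ (D + 1 + norm (y - a))) => eta /andP[eta0 _].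
  have [N /(_ _ (leqnn N)) HN] := inv_nat_eventually_lt eta0.
  apply: le_trans (proj2 (Hp N) y u Byu) _.
  by rewrite add0r mulrC; apply: ler_wpM2r => //; apply: ltW.
apply/ler_addgt0Pr => eta eta0.
have := Hmin _ (fun n => near_sqr n _ eta0).
rewrite r0 add0r -(sqr_hnorm ipP).
have [w [_ le]] := near 0%N _ eta0.
by have := hnorm_ge0 ip (w - a); have := hnorm_ge0 ip (p - a); nra.
Qed.

End MonotoneInclusion.

(** * Estimates for one forward-backward step *)

Section ForwardBackwardStep.
Variables (R : realType) (V : lmodType R) (ip : V -> V -> R).
Hypothesis hV : hilbert ip.
Let ipP : is_inner_product ip := proj1 hV.
Local Notation norm := (hnorm ip).
Implicit Types (A T : V -> V) (B : V -> V -> Prop).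

Lemma halfspace_convex c q (r : R) : hconvex (fun v : V => ip c (v - q) <= r).
Proof.
move=> v w t /= hv hw /andP[t0 t1].
have -> : ip c (t *: v + (1 - t) *: w - q) = t * ip c (v - q) + (1 - t) * ip c (w - q).
  rewrite !(ipE ipP); ring.
nra.
Qed.

Lemma forward_backward_mem a B g v z : a != 0 -> is_resolvent a B (v - a *: g) z ->
  B z (a^-1 *: (v - z) - g).
Proof.
move=> a0 [u [Bzu E]].
suff -> : a^-1 *: (v - z) - g = u by [].
apply: (scalerI a0); rewrite scalerBr scalerA mulfV // scale1r.
by rewrite addrAC E addrAC subrr add0r.
Qed.

(** The residual divided by the step size does not increase with the step size. The common term [g]
    cancels in the monotonicity inequality. *)
Lemma forward_backward_dist a b B g v z z' : monotone_op ip B -> 0 < a -> a <= b ->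
  is_resolvent a B (v - a *: g) z -> is_resolvent b B (v - b *: g) z' ->
  a * norm (v - z') <= b * norm (v - z).
Proof.
move=> mB a0 ab; have b0 := lt_le_trans a0 ab.
move=> /(forward_backward_mem (lt0r_neq0 a0)) Bz /(forward_backward_mem (lt0r_neq0 b0)) Bz'.
have := mB _ _ _ _ Bz Bz'.
have -> : z - z' = (v - z') - (v - z) by rewrite opprB [RHS]addrC subrKA.
move: (v - z) (v - z') => p q.
have -> : a^-1 *: p - g - (b^-1 *: q - g) = a^-1 *: p - b^-1 *: q.
  by rewrite opprB addrA subrK.
rewrite !(ipE ipP) -!(sqr_hnorm ipP) (ipC ipP q p) => L.
have {}L : 0 <= (b + a) * ip p q - b * norm p ^+ 2 - a * norm q ^+ 2.
  have -> : (b + a) * ip p q - b * norm p ^+ 2 - a * norm q ^+ 2 =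
    (a * b) * (a^-1 * ip p q + - (b^-1 * norm q ^+ 2) +
       - (a^-1 * norm p ^+ 2 + - (b^-1 * ip p q))).
    by field; rewrite !gt_eqF.
  apply: mulr_ge0; first by apply: mulr_ge0; apply: ltW.
  by rewrite opprD.
have := cauchy_schwarz ipP p q; have := hnorm_ge0 ip p; have := hnorm_ge0 ip q.
move: L; move: (norm p) (norm q) (ip p q) => P Q s L Q0 P0 sPQ.
have [//|lt] := leP (a * Q) (b * P).
have PQ : P < Q.
  by rewrite -(ltr_pM2l a0); apply: le_lt_trans lt; apply: ler_wpM2r.
(* Cauchy-Schwarz turns [L] into the opposite sign for this same product. *)
have : 0 < (a * Q - b * P) * (Q - P) by rewrite mulr_gt0 ?subr_gt0.
have : (b + a) * s <= (b + a) * (P * Q) by rewrite ler_pM2l ?addr_gt0.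
lra.
Qed.

(* Cocoercivity of [A1] costs at most [<A1 v - A1 p, p - z> <= |v - z|^2 / (4 beta)],
   which the slack [dbar / a |v - z|^2] of the half-space absorbs as [a <= 4 beta dbar]. *)
Lemma zer_sub_halfspace A1 A2 B beta dbar a v z p :
  0 < beta -> cocoercive ip beta A1 -> monotone_op ip (graph A2) -> monotone_op ip B ->
  0 < a -> a <= 4 * beta * dbar ->
  is_resolvent a B (v - a *: (A1 v + A2 v)) z -> zer (fun w => A1 w + A2 w) B p ->
  ip (a^-1 *: (v - z) - (A2 v - A2 z)) (p - z) <= dbar / a * norm (v - z) ^+ 2.
Proof.
move=> b0 cA1 mA2 mB a0 ab /(forward_backward_mem (lt0r_neq0 a0)) Bz [u [Bpu Eu]].
have uE : u = - (A1 p + A2 p) by apply/eqP; rewrite -addr_eq0 addrC Eu.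
have m1 := mB _ _ _ _ Bz Bpu; rewrite uE in m1.
have m2 := mA2 z p _ _ erefl erefl; have m3 := cA1 v p.
have cs := cauchy_schwarz ipP (A1 v - A1 p) (v - z).
have E : ip (a^-1 *: (v - z) - (A2 v - A2 z)) (p - z) =
   - ip (z - p) (a^-1 *: (v - z) - (A1 v + A2 v) - - (A1 p + A2 p))
   - ip (z - p) (A2 z - A2 p) - ip (A1 v - A1 p) (v - p) + ip (A1 v - A1 p) (v - z).
  rewrite !(ipC ipP (z - p)) !(ipE ipP); ring.
rewrite {}E.
have : norm (A1 v - A1 p) * norm (v - z) - beta * norm (A1 v - A1 p) ^+ 2 <=
    dbar / a * norm (v - z) ^+ 2.
  have : 1 <= 4 * beta * (dbar / a) by rewrite mulrA ler_pdivlMr // mul1r.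
  move: (norm (A1 v - A1 p)) (norm (v - z)) (dbar / a) => P Q k bk.
  have : 0 <= (2 * beta * P - Q) ^+ 2 by exact: sqr_ge0.
  have : 0 <= (4 * beta * k - 1) * Q ^+ 2 by rewrite mulr_ge0 ?sqr_ge0 ?subr_ge0.
  move=> h1 h2; rewrite -(ler_pM2l (mulr_gt0 (ltr0n R 4) b0)); lra.
lra.
Qed.

(** The accepted test bounds [ip w (v - z)] below by [(1 - delta) * norm (v - z) ^+ 2], and the
    half-space bounds [ip w (y - z)] above. Their difference is [ip w (v - y)], so a short step
    [v - y] forces a small residual. *)
Lemma halfspace_step_bound T a delta dbar v z y : 0 < a ->
  a * ip (T v - T z) (v - z) <= delta * norm (v - z) ^+ 2 ->
  ip (a^-1 *: (v - z) - (T v - T z)) (y - z) <= dbar / a * norm (v - z) ^+ 2 ->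
  (1 - delta - dbar) * norm (v - z) ^+ 2 <=
    (norm (v - z) + a * norm (T v - T z)) * norm (v - y).
Proof.
move=> a0 Hc HT; set w := v - z - a *: (T v - T z).
have aN0 : a != 0 by rewrite gt_eqF.
have {HT} HT : ip w (y - z) <= dbar * norm (v - z) ^+ 2.
  rewrite -(ler_pM2l a0) in HT; move: HT.
  rewrite -(ipZl ipP) scalerBr scalerA mulfV // scale1r => /le_trans; apply.
  by rewrite le_eqVlt; apply/orP; left; apply/eqP; field.
have E : ip w (y - z) = ip (v - z) (v - z) - a * ip (T v - T z) (v - z) - ip w (v - y).
  by rewrite /w !(ipE ipP); ring.
have wn : norm w <= norm (v - z) + a * norm (T v - T z).
  apply: le_trans (ler_hnormD ipP _ _) _.
  by rewrite (hnormN ipP) (hnormZ ipP) gtr0_norm.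
have := cauchy_schwarz ipP w (v - y); have := hnorm_ge0 ip (v - y).
move: HT; rewrite E -(sqr_hnorm ipP) => *; nra.
Qed.

(** Controls the scaled residual without any lower bound on the step size [a]. *)
Lemma line_search_failure_bound T a delta v z :
  0 < a -> 0 < delta ->
  ~ a * ip (T v - T z) (v - z) <= delta * norm (v - z) ^+ 2 ->
  a^-1 * norm (v - z) <= norm (T v - T z) / delta.
Proof.
move=> a0 d0 /negP; rewrite -ltNge => lt.
rewrite ler_pdivlMr // mulrAC -mulrA mulrC ler_pdivrMr //.
have := cauchy_schwarz ipP (T v - T z) (v - z).
have := hnorm_ge0 ip (v - z); have := hnorm_ge0 ip (T v - T z).
move: (norm (T v - T z)) (norm (v - z)) (ip _ _) lt => P Q s lt P0 Q0 sPQ.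
have [Q_eq0|QN0] := eqVneq Q 0; first by rewrite Q_eq0 mulr0 mulr_ge0 // ltW.
have Q_gt0 : 0 < Q by rewrite lt_def QN0.
rewrite -(ler_pM2r Q_gt0); nra.
Qed.

Lemma forward_backward_approx_zer A B a v z : a != 0 ->
  is_resolvent a B (v - a *: A v) z ->
  exists e, B z (e - A z) /\ norm e <= `|a^-1| * norm (v - z) + norm (A v - A z).
Proof.
move=> a0 /(forward_backward_mem a0) Bz.
exists (a^-1 *: (v - z) - (A v - A z)); split.
  by have -> : a^-1 *: (v - z) - (A v - A z) - A z = a^-1 *: (v - z) - A v;
    rewrite // opprB addrA addrAC addrK.
by apply: le_trans (ler_hnormD ipP _ _) _; rewrite (hnormN ipP) (hnormZ ipP).
Qed.

End ForwardBackwardStep.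

(** * Convergence of the method *)

Section Method2.
Variables (R : realType) (V : lmodType R) (ip : V -> V -> R).
Variables (A1 A2 : V -> V) (B : V -> V -> Prop).
Variables (beta theta delta dbar am1 : R).
Variables (x : nat -> V) (alpha : nat -> R) (jk : nat -> nat) (xb : nat -> V).
Hypothesis hV : hilbert ip.
Hypothesis beta_gt0 : 0 < beta.
Hypothesis cA1 : cocoercive ip beta A1.
Hypothesis mA2 : max_monotone_op ip (graph A2).
Hypothesis cA2 : unif_continuous ip A2.
Hypothesis mB : max_monotone_op ip B.
Hypothesis theta01 : 0 < theta < 1.
Hypothesis delta01 : 0 < delta < 1.
Hypothesis slack_gt0 : 0 < 1 - delta - dbar.
Hypothesis am1_gt0 : 0 < am1.
Hypothesis am1_le : am1 <= 4 * beta * dbar.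
Hypothesis run : method2_run ip A1 A2 B theta delta dbar am1 x alpha jk xb.

Let ipP : is_inner_product ip := proj1 hV.
Let A v := A1 v + A2 v.
Let aprev k := if k is k'.+1 then alpha k' else am1.
Local Notation norm := (hnorm ip).
Local Notation x0 := (x 0%N).

Let theta_gt0 : 0 < theta. Proof. by case/andP: theta01. Qed.
Let theta_lt1 : theta < 1. Proof. by case/andP: theta01. Qed.
Let delta_gt0 : 0 < delta. Proof. by case/andP: delta01. Qed.

Let alphaE k : alpha k = aprev k * theta ^+ jk k.
Proof. by case: run. Qed.

Let xbP k : is_resolvent (alpha k) B (x k - alpha k *: A (x k)) (xb k).
Proof. by case: run. Qed.

Lemma stepsize_bounds k : 0 < alpha k /\ alpha k <= am1.
Proof.
have step j : 0 < theta ^+ j <= 1.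
  by rewrite exprn_gt0 //= exprn_ile1 // ltW.
elim: k => [|k [IH0 IH1]]; rewrite alphaE /=.
  have /andP[h0 h1] := step (jk 0%N); split; first exact: mulr_gt0.
  by rewrite ler_piMr // ltW.
have /andP[h0 h1] := step (jk k.+1); split; first exact: mulr_gt0.
by apply: le_trans IH1; rewrite ler_piMr // ltW.
Qed.

Let alpha_gt0 k : 0 < alpha k := proj1 (stepsize_bounds k).
Let alpha_neq0 k : alpha k != 0 := lt0r_neq0 (alpha_gt0 k).

Let Tk k v := ip ((alpha k)^-1 *: (x k - xb k) - (A2 (x k) - A2 (xb k))) (v - xb k)
  <= dbar / alpha k * norm (x k - xb k) ^+ 2.
Let Gk k v := ip (x0 - x k) (v - x k) <= 0.

Let xSP k : is_proj ip (fun v => Tk k v /\ Gk k v) x0 (x k.+1).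
Proof. by case: run => _ _ _ _; apply. Qed.

Lemma zer_sub_Tk k p : zer A B p -> Tk k p.
Proof.
have [a0 a1] := stepsize_bounds k.
exact: (zer_sub_halfspace hV beta_gt0 cA1 (proj1 mA2) (proj1 mB) a0 (le_trans a1 am1_le) (xbP k)).
Qed.

(** Induction: [Gk k.+1] is the variational inequality of the projection defining [x k.+1], valid on
    [Tk k] and [Gk k] together. *)
Lemma zer_sub_Gk k p : zer A B p -> Gk k p.
Proof.
elim: k p => [|k IH] p Zp; first by rewrite /Gk subrr (ip0l ipP).
have cTG : hconvex (fun v => Tk k v /\ Gk k v).
  move=> v w t [Tv Gv] [Tw Gw] t01; split.
    exact: (halfspace_convex hV Tv Tw t01).
  exact: (halfspace_convex hV Gv Gw t01).
by apply: (proj_variational ipP cTG (xSP k)); split; [exact: zer_sub_Tk | exact: IH].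
Qed.

(** [Gk] makes the angle at [x k] between [x0] and [v] right or obtuse. *)
Lemma sqr_dist_Gk k v : Gk k v ->
  norm (x k - x0) ^+ 2 + norm (v - x k) ^+ 2 <= norm (v - x0) ^+ 2.
Proof.
rewrite /Gk !(sqr_hnorm ipP) !(ipE ipP).
rewrite (ipC ipP v x0) (ipC ipP v (x k)) (ipC ipP (x k) x0); lra.
Qed.

Hypothesis zer_neq0 : exists p, zer A B p.

Lemma asymptotic_regularity e : 0 < e ->
  exists N, forall k, (N <= k)%N -> norm (x k - x k.+1) < e.
Proof.
move=> e0; have [p Zp] := zer_neq0.
have [l [sl Hl]] := @nondecreasing_bounded_limit R (fun k => norm (x k - x0) ^+ 2)
  (norm (p - x0) ^+ 2)
  (fun k => le_trans (ler_wpDr (sqr_ge0 _) (lexx _)) (sqr_dist_Gk (proj2 (proj1 (xSP k)))))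
  (fun k => le_trans (ler_wpDr (sqr_ge0 _) (lexx _)) (sqr_dist_Gk (zer_sub_Gk k Zp))).
have [N HN] := Hl _ (exprn_gt0 2 e0); exists N => k /HN lt.
have := sqr_dist_Gk (proj2 (proj1 (xSP k))); have := sl k.+1.
rewrite (hdistC ipP (x k.+1) (x k)) => L1 L2.
have : norm (x k - x k.+1) ^+ 2 < e ^+ 2 by lra.
by have := hnorm_ge0 ip (x k - x k.+1); nra.
Qed.

Lemma forward_backward_residual e : 0 < e ->
  exists N, forall k, (N <= k)%N -> norm (x k - xb k) < e.
Proof.
move=> e0; have [C [C0 HC]] := unif_continuous_affine_bound hV cA2.
pose K := 1 + am1 * C; pose kap := 1 - delta - dbar.
have amC : 0 < am1 * C by rewrite mulr_gt0.
have K0 : 0 < K by rewrite /K; lra.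
(* The residual [d] and the step [h] satisfy [kap * d ^+ 2 <= K * (1 + d) * h]. Since d^2 / (1 + d)
   increases, [d >= e] would force [h] to reach this threshold. *)
have e1 : 0 < kap * e ^+ 2 / (K * (e + 1)).
  by rewrite divr_gt0 // mulr_gt0 ?exprn_gt0 //; lra.
have [N HN] := asymptotic_regularity e1; exists N => k /HN.
have [a0 a1] := stepsize_bounds k.
have [_ _ /(_ k) Hc _ _] := run; rewrite /= in Hc.
have := halfspace_step_bound hV a0 Hc (proj1 (proj1 (xSP k))).
rewrite -/kap; have := HC (x k) (xb k); have := hnorm_ge0 ip (A2 (x k) - A2 (xb k)).
have := hnorm_ge0 ip (x k - xb k); have := hnorm_ge0 ip (x k - x k.+1).
move: (norm (x k - xb k)) (norm (x k - x k.+1)) (norm (A2 _ - A2 _)).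
move=> d h L h0 d0 L0 LC Hd; rewrite ltr_pdivlMr; last by rewrite mulr_gt0 //; lra.
move=> hlt; have [//|ed] := ltP d e; exfalso.
have L1 : alpha k * L <= am1 * C * (1 + d).
  by rewrite -mulrA; apply: ler_pM => //; exact: ltW.
have L2 : kap * d ^+ 2 <= K * (1 + d) * h.
  apply: (le_trans Hd); apply: ler_wpM2r => //.
  by rewrite /K; lra.
have kap0 : 0 < kap by [].
have d_gt0 := lt_le_trans e0 ed.
have L3 : e ^+ 2 * (1 + d) <= d ^+ 2 * (1 + e).
  have : 0 <= (d - e) * (d + e + d * e).
    by rewrite mulr_ge0 ?subr_ge0 // addr_ge0 ?mulr_ge0 ?addr_ge0 // ltW.
  lra.
have L4 : kap * (e ^+ 2 * (1 + d)) <= kap * (d ^+ 2 * (1 + e)) by rewrite ler_pM2l.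
have L5 : kap * d ^+ 2 * (1 + e) <= K * (1 + d) * h * (1 + e).
  by rewrite ler_wpM2r //; lra.
have d1 : 0 < 1 + d by lra.
have : (1 + d) * (h * (K * (e + 1))) < (1 + d) * (kap * e ^+ 2) by rewrite ltr_pM2l.
lra.
Qed.

Let cA : unif_continuous ip A.
Proof. exact: unif_continuousD (cocoercive_unif_continuous hV beta_gt0 cA1) cA2. Qed.

Lemma approx_zer_near_iterates D eps : (forall k, norm (x k - x0) <= D) -> 0 < eps ->
  exists w e, [/\ B w (e - A w), norm e <= eps & norm (w - x0) <= D + eps].
Proof.
move=> HD eps0; have eps2 : 0 < eps / 2 by rewrite divr_gt0.
have [d1 [d1_gt0 Hd1]] := cA eps2.
have near_x0 k w : norm (x k - w) <= eps -> norm (w - x0) <= D + eps.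
  move=> h; apply: (le_trans (ler_hnorm_distD ipP (x k) _ _)).
  by rewrite (hdistC ipP w) addrC lerD.
(* Eventually constant step sizes stay away from 0, so small residuals suffice. Otherwise they may
   vanish, and [line_search_failure_bound] takes over. *)
have [[N HN]|inf_fail] := pselect (exists N, forall k, (N <= k)%N -> jk k = 0%N).
  have aconst k : (N <= k)%N -> alpha k = alpha N.
    move=> /subnK <-; elim: (k - N)%N => // m IH.
    by rewrite addSn alphaE /= HN ?expr0 ?mulr1 // leqW // leq_addl.
  pose m := Num.min d1 (Num.min eps (alpha N * (eps / 2))).
  have m0 : 0 < m by rewrite !lt_min d1_gt0 eps0 mulr_gt0.
  have [M HM] := forward_backward_residual m0.
  pose k := maxn N M; have := HM k (leq_maxr _ _).
  rewrite !lt_min => /and3P[h1 h2 h3].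
  have [e [Be le]] := forward_backward_approx_zer hV (alpha_neq0 k) (xbP k).
  exists (xb k), e; split=> //; last by apply: (near_x0 k); exact: ltW.
  apply: (le_trans le); rewrite gtr0_norm ?invr_gt0 // (aconst k (leq_maxl _ _)).
  have := ltW (Hd1 _ _ h1).
  by have := h3; rewrite -ltr_pdivrMl // => /ltW; lra.
(* The last rejected trial point [z] has step [alpha k / theta], so it is at most
   [theta^-1] times as far from [x k] as [xb k]. *)
have [d2 [d2_gt0 Hd2]] := cA2 (mulr_gt0 delta_gt0 eps2).
pose m := Num.min d1 (Num.min eps d2).
have m0 : 0 < m by rewrite !lt_min d1_gt0 eps0.
have [M HM] := forward_backward_residual (mulr_gt0 theta_gt0 m0).
have [k [Mk jk_gt0]] : exists k, (M <= k)%N /\ (0 < jk k)%N.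
  apply: contrapT => H; apply: inf_fail; exists M => k Mk.
  by apply/eqP; rewrite -leqn0 leqNgt; apply/negP => j0; apply: H; exists k.
pose a := aprev k * theta ^+ (jk k).-1.
have aE : alpha k = theta * a.
  by rewrite alphaE /a mulrCA -exprS prednK.
have a0 : 0 < a by have := alpha_gt0 k; rewrite aE pmulr_rgt0.
have [z Hz] := minty hV (x k - a *: A (x k)) mB a0.
have j_lt : ((jk k).-1 < jk k)%N by rewrite prednK.
have [_ _ _ /(_ k _ j_lt z Hz) Hfail _] := run.
have ratio := line_search_failure_bound hV a0 delta_gt0 Hfail.
have close : norm (x k - z) < m.
  have aka : alpha k <= a by rewrite aE ler_piMl // ltW.
  have := forward_backward_dist hV (proj1 mB) (alpha_gt0 k) aka (xbP k) Hz.
  rewrite aE -mulrA mulrCA ler_pM2l // => L.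
  by rewrite -(ltr_pM2l theta_gt0); apply: le_lt_trans L (HM k Mk).
move: close; rewrite !lt_min => /and3P[h1 h2 h3].
have [e [Be le]] := forward_backward_approx_zer hV (lt0r_neq0 a0) Hz.
exists z, e; split=> //; last by apply: (near_x0 k); exact: ltW.
apply: (le_trans le); rewrite gtr0_norm ?invr_gt0 //.
have := ltW (Hd1 _ _ h1); have := ltW (Hd2 _ _ h3).
have : norm (A2 (x k) - A2 z) / delta <= eps / 2 ->
   a^-1 * norm (x k - z) <= eps / 2 by exact: le_trans.
by rewrite ler_pdivrMr // mulrC => H /H; lra.
Qed.

Lemma dist_zer_le_of_bound D : (forall k, norm (x k - x0) <= D) ->
  exists p, zer A B p /\ norm (p - x0) <= D.
Proof.
move=> HD; apply: (zer_of_approx_zer hV _ cA mB).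
  move=> v w; have := proj1 mA2 v w _ _ erefl erefl; have := cA1 v w.
  have : 0 <= beta * norm (A1 v - A1 w) ^+ 2 by rewrite mulr_ge0 ?sqr_ge0 // ltW.
  have -> : A v - A w = (A1 v - A1 w) + (A2 v - A2 w) by rewrite /A opprD addrACA.
  by rewrite (ipC ipP (v - w)) (ipDl ipP (A1 v - A1 w) (A2 v - A2 w)); lra.
by move=> eps; apply: approx_zer_near_iterates.
Qed.

(** If the squared distances to [x0] never exceeded [norm (xbar - x0) ^+ 2 - e ^+ 2], then
    [dist_zer_le_of_bound] would yield a zero closer to [x0] than [xbar]. Once they exceed it, they
    do so forever, and [sqr_dist_Gk] at [xbar] gives the rate. *)
Lemma method2_cvg xbar : is_proj ip (zer A B) x0 xbar -> hcvg ip x xbar.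
Proof.
move=> [Zxbar Hmin] e e0.
suff [k0 Hk0] : exists k, norm (xbar - x0) ^+ 2 - e ^+ 2 < norm (x k - x0) ^+ 2.
  exists k0 => k k0k.
  have : norm (x k0 - x0) ^+ 2 <= norm (x k - x0) ^+ 2.
    rewrite -(subnK k0k); elim: (k - k0)%N => // m /le_trans; apply; rewrite addSn.
    by apply: le_trans (sqr_dist_Gk (proj2 (proj1 (xSP _)))); rewrite lerDl sqr_ge0.
  have := sqr_dist_Gk (zer_sub_Gk k Zxbar); rewrite (hdistC ipP xbar (x k)) => L1 L2.
  have : norm (x k - xbar) ^+ 2 < e ^+ 2 by lra.
  by have := hnorm_ge0 ip (x k - xbar); nra.
apply: contrapT => H.
pose D2 := norm (xbar - x0) ^+ 2 - e ^+ 2.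
have HD2 k : norm (x k - x0) ^+ 2 <= D2.
  by rewrite leNgt; apply/negP => lt; apply: H; exists k.
(* [Num.sqrt] is 0 on negative numbers, so squaring [Num.sqrt D2] back requires this sign. *)
have D20 : 0 <= D2 by apply: le_trans (HD2 0%N); exact: sqr_ge0.
have [k|p [Zp Hp]] := @dist_zer_le_of_bound (Num.sqrt D2).
  by rewrite -(ger0_norm (hnorm_ge0 ip _)) -sqrtr_sqr ler_wsqrtr.
have := Hmin _ Zp; rewrite (hdistC ipP x0) (hdistC ipP x0) => L.
have := le_trans L Hp.
have := sqr_sqrtr D20; rewrite {2}/D2 => E.
have := hnorm_ge0 ip (xbar - x0); have := sqrtr_ge0 D2; have := exprn_gt0 2 e0; nra.
Qed.

End Method2.

Theorem theorem4p15 (R : realType) (V : lmodType R) (ip : V -> V -> R)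
  (A1 A2 : V -> V) (B : V -> V -> Prop)
  (beta theta delta dbar am1 : R)
  (x : nat -> V) (alpha : nat -> R) (jk : nat -> nat) (xb : nat -> V)
  (xbar : V) :
  hilbert ip ->
  0 < beta -> cocoercive ip beta A1 ->
  max_monotone_op ip (graph A2) -> unif_continuous ip A2 ->
  max_monotone_op ip B ->
  0 < theta < 1 -> 0 < delta < 1 -> 0 < dbar -> 0 < 1 - delta - dbar ->
  0 < am1 -> am1 <= 4 * beta * dbar ->
  (exists z, zer (fun v => A1 v + A2 v) B z) ->
  hclosed ip (zer (fun v => A1 v + A2 v) B) ->
  hconvex (zer (fun v => A1 v + A2 v) B) ->
  method2_run ip A1 A2 B theta delta dbar am1 x alpha jk xb ->
  (forall k, x k.+1 <> x k) ->
  is_proj ip (zer (fun v => A1 v + A2 v) B) (x 0%N) xbar ->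
  hcvg ip x xbar.
Proof.
move=> hV b0 cA1 mA2 cA2 mB th de _ sl a0 ale zne _ _ run _ pr.
exact: (method2_cvg hV b0 cA1 mA2 cA2 mB th de sl a0 ale run zne pr).
Qed.
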